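(* For every $k\in\mathbb{N}$, $$\zeta_{MT,2k+1}(2,\{1\}^{2k};1)=(2k)!\left\{\zeta(2)\zeta(2k+1)-\frac12(2k^2+k-2)\zeta(2k+3)+\sum_{n=1}^{k-1}(2k+1-2n)\,\zeta(2n+1)\,\zeta(2k+2-2n)\right\}.$$
   Context: $\mathbb{N}=\{1,2,3,\dots\}$. $\{1\}^{n}$ denotes $n$ repetitions of $1$. $\zeta$ is the Riemann zeta function. The Mordell-Tornheim $r$-ple zeta value is $$\zeta_{MT,r}(k_1,\dots,k_r;k_{r+1})=\sum_{m_1,\dots,m_r=1}^\infty\frac{1}{m_1^{k_1}\cdots m_r^{k_r}(m_1+\cdots+m_r)^{k_{r+1}}}.$$ An empty sum is $0$. *)

(* Defs.v *)
From mathcomp Require Import all_boot all_order all_algebra.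
From mathcomp Require Import all_classical all_reals all_analysis.

Set Implicit Arguments.
Unset Strict Implicit.
Unset Printing Implicit Defensive.

Import Order.TTheory GRing.Theory Num.Theory.
Import numFieldNormedType.Exports.

Local Open Scope classical_set_scope.
Local Open Scope ring_scope.

(* The Dirichlet series of the Riemann zeta function at a natural number s,
   meaningful only for 2 <= s, where it converges. *)
Definition zeta (R : realType) (s : nat) : R :=
  limn (series (fun n => n.+1%:R ^- s : R)).
Arguments zeta R s : clear implicits.

(* The Mordell-Tornheim r-ple zeta value, as an unordered sum over all r-tuples
   of positive integers. The terms being nonnegative, an equality with a finite
   real number asserts both the convergence of the series and its value. *)
Definition zeta_MT (R : realType) (r : nat) (k : r.-tuple nat) (l : nat) :
    \bar R :=
  \esum_(m in [set m : {ffun 'I_r -> nat} | forall i, (0 < m i)%N])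
    ((\prod_(i < r) (m i)%:R ^+ tnth k i) *
       (\sum_(i < r) (m i)%:R) ^+ l)^-1%:E.
Arguments zeta_MT R r k l : clear implicits.

(* Main.v *)
Require Import Defs.
From mathcomp Require Import all_boot all_order all_algebra.
From mathcomp Require Import all_classical all_reals all_analysis.
From mathcomp Require Import ring lra zify.

(** All identities are arranged between series with nonnegative terms, so the
sums are taken in the extended reals, where they can be reordered freely; convergence comes out as a
by-product. Summation indices start at 0 and [harmonic i] is 1/(i+1), so that an
index [i] stands for the positive integer i+1. In this comment, p = 2k, q = p+1
and zeta(a,b) is the sum of n^-a l^-b over 1 <= l < n.

Reduction to a double sum. Fix the summation variable a that carries the
exponent 2. What remains is F_p(a), where F_r(a) is the sum of
1/(m_1 ... m_r (m_1+...+m_r+a)) over positive m_1, ..., m_r. By symmetry one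
variable can be freed from its weight, the sum over it telescopes, and
  a F_(r+1)(a) = (r+1) (F_r(1) + ... + F_r(a))
([tornheim_tailS]). The integral over [0,1] of (1-t)^(a-1) (-log t)^r satisfies
the same recursion. Integrals of this kind, with an additional factor t^n, are
iterated differences of inverse powers, and in this guise they enter the proof
([tornheim_tailE]). Pascal's rule for them, combined with integration by parts,
trades a factor 1/a against a sum over a new variable
([log_moment_transport]). Doing this twice, once for each factor of 1/a^2,
leaves p! times the sum over l < n of
  1 n^-2 l^-(p+1) + 2 n^-3 l^-p + ... + (p+1) n^-(p+2) l^-1
([zeta_MT_double_sum]).

Reduction to two double zeta values. That inner sum has a closed form in terms
of l, n and n-l ([weighted_power_sumE]). Summed over l < n, and using the
splitting of zeta(2) zeta(q) along the diagonal, it gives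
  zeta(q+2) + zeta(2,q) - q zeta(q+1,1)
([dseries_weighted_power_sum]).

Parity. The two double zeta values need not be evaluated separately. The
products of zeta values in the theorem add up to a double series over all pairs
(a,b), whose terms also have a closed form, this time in 1/(a-b) and 1/(a+b)
([parity_sumE]); this is where p has to be even. Adding the terms at (l,n) and
(n,l) removes the squares of 1/(n-l), and what is left sums over l < n to
  zeta(2,q) - q zeta(q+1,1) + (k/2) zeta(q+2)
([dseries_parity_sum_off_diagonal]). The diagonal contributes k^2 zeta(q+2).
Eliminating the double zeta values between the two evaluations gives the
theorem. *)

Set Implicit Arguments.
Unset Strict Implicit.
Unset Printing Implicit Defensive.

Import Order.TTheory GRing.Theory Num.Theory.
Import numFieldNormedType.Exports.

Local Open Scope classical_set_scope.
Local Open Scope ring_scope.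

Arguments harmonic {R} n : simpl never.

(** * Nonnegative series *)

Section nonnegative_series.
Variable R : realType.
Implicit Types (F : nat -> nat -> \bar R) (u v : nat -> R).
Local Open Scope ereal_scope.

Lemma eq_nneseries (f g : nat -> \bar R) : f =1 g ->
  \sum_(i <oo) f i = \sum_(i <oo) g i.
Proof. by move=> fg; apply: eq_eseriesr => i _; exact: fg. Qed.

(** Both sides enumerate the pairs i < n, by rows and by columns; the inner
index [m] on the left is the gap n - i - 1. *)
Lemma nneseries_lt_triangle F : (forall i j, 0 <= F i j) ->
  \sum_(i <oo) \sum_(m <oo) F i (i + m).+1 =
  \sum_(n <oo) \sum_(0 <= i < n) F i n.
Proof.
move=> F0.
pose G i n := if (i < n)%N then F i n else 0.
have G0 i n : 0 <= G i n by rewrite /G; case: ifP.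
transitivity (\sum_(i <oo) \sum_(n <oo) G i n).
  apply: eq_nneseries => i.
  rewrite [RHS](nneseries_split 0 i.+1)//= add0n.
  rewrite big_nat big1 ?add0r; last first.
    by move=> n /andP[_]; rewrite ltnS /G leqNgt; case: ifP.
  rewrite -(nneseries_addn (f := G i))//; apply: eq_nneseries => m.
  by rewrite /G addnS ltnS leq_addl addnC.
rewrite nneseries_interchange//; apply: eq_nneseries => n.
rewrite (nneseries_split 0 n)//= add0n eseries0 ?adde0; last first.
  by move=> i ni _; rewrite /G ltnNge ni.
by apply: eq_big_nat => i /andP[_ ni]; rewrite /G ni.
Qed.

Lemma nneseries_split_diagonal F : (forall i j, 0 <= F i j) ->
  \sum_(i <oo) \sum_(j <oo) F i j =
  \sum_(i <oo) F i i + \sum_(i <oo) \sum_(m <oo) F i (i + m).+1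
  + \sum_(i <oo) \sum_(m <oo) F (i + m).+1 i.
Proof.
move=> F0.
rewrite [X in _ + X](@nneseries_lt_triangle (fun i j => F j i))//.
rewrite -nneseriesD//; last by move=> *; exact: nneseries_ge0.
rewrite -nneseriesD//; first last.
- by move=> *; exact: sume_ge0.
- by move=> *; rewrite adde_ge0//; exact: nneseries_ge0.
apply: eq_nneseries => i.
rewrite (nneseries_split 0 i)//= add0n (nneseries_split i 1)//= addn1 big_nat1.
rewrite [LHS]addeC; congr (_ + _ + _).
rewrite -(nneseries_addn (f := F i))//; apply: eq_nneseries => m.
by rewrite addnS addnC.
Qed.

Lemma nneseriesZlR (c : R) u : (forall i, 0 <= u i)%R ->
  \sum_(i <oo) (c * u i)%:E = c%:E * \sum_(i <oo) (u i)%:E.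
Proof.
move=> u0; by rewrite -nneseriesZl// => i _; rewrite lee_fin.
Qed.

Lemma nneseriesDR (u v : nat -> R) :
  (forall i, 0 <= u i)%R -> (forall i, 0 <= v i)%R ->
  \sum_(i <oo) (u i + v i)%:E = \sum_(i <oo) (u i)%:E + \sum_(i <oo) (v i)%:E.
Proof. by move=> u0 v0; rewrite -nneseriesD// => i _ _; rewrite lee_fin. Qed.

Lemma nneseries_telescope u : u @ \oo --> (0 : R)%R ->
  \sum_(i <oo) (u i - u i.+1)%:E = (u 0%N)%:E.
Proof.
move=> u0; apply/cvg_lim => //=.
have -> : (fun n => \sum_(0 <= i < n) (u i - u i.+1)%:E) =
          EFin \o (fun n => u 0%N - u n)%R.
  apply/funext => n /=; rewrite sumEFin -opprB -telescope_sumr// -sumrN.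
  by congr _%:E; apply: eq_bigr => i _; rewrite opprB.
apply: cvg_EFin; first by near=> n.
rewrite -[X in _ --> X]subr0; apply: cvgB => //; exact: cvg_cst.
Unshelve. all: by end_near. Qed.

(** A difference with lag [b] telescopes to the first [b] terms: it is the
forward difference of the sums over windows of length [b]. *)
Lemma nneseries_telescope_block u b : u @ \oo --> (0 : R)%R ->
  \sum_(i <oo) (u i - u (i + b)%N)%:E = (\sum_(0 <= c < b) u c)%:E.
Proof.
move=> u0; pose v n : R := (\sum_(0 <= c < b) u (n + c)%N)%R.
have -> : (\sum_(0 <= c < b) u c = v 0%N)%R by [].
rewrite -(nneseries_telescope (u := v)); last first.
  rewrite /v; elim: b {v} => [|b IHb].
    by under eq_fun do rewrite big_geq//; exact: cvg_cst.
  rewrite -[X in _ --> X]addr0.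
  under eq_fun do rewrite (big_nat_recr b)//=.
  apply: cvgD => //.
  by move: u0; rewrite -(cvg_shiftn b).
apply: eq_nneseries => i; congr _%:E; rewrite /v.
rewrite -sumrB -[LHS]opprB -{2}(addn0 i).
rewrite -(telescope_sumr (fun c => u (i + c)%N))// -sumrN.
by apply: eq_bigr => c _; rewrite opprB addSnnS.
Qed.

Lemma harmonicE i : (harmonic i = i.+1%:R^-1 :> R)%R.
Proof. by []. Qed.

Lemma harmonic_pow_ge0 s i : (0 <= harmonic i ^+ s :> R)%R.
Proof. by rewrite exprn_ge0// harmonic_ge0. Qed.

Lemma harmonic_le1 i : (harmonic i <= 1 :> R)%R.
Proof. by rewrite harmonicE invf_le1// ler1n. Qed.

Lemma harmonic_decr i j : (i <= j)%N -> (harmonic j <= harmonic i :> R)%R.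
Proof. by move=> ij; rewrite !harmonicE lef_pV2 ?posrE ?ltr0n// ler_nat. Qed.

(** The comparison of 1/(i+1)^2 with 2/(i+1) - 2/(i+2) makes the series
converge, so that the limit defining [zeta] is the value of the sum. *)
Lemma zetaE s : (2 <= s)%N -> \sum_(i <oo) (harmonic i ^+ s)%:E = (zeta R s)%:E.
Proof.
move=> s2.
have bnd i : (harmonic i ^+ s <= 2 * (harmonic i - harmonic i.+1) :> R)%R.
  apply: (@le_trans _ _ (harmonic i ^+ 2)%R).
    by rewrite ler_wiXn2l ?harmonic_ge0 ?harmonic_le1.
  rewrite !harmonicE -(natr1 i.+1) -(natr1 i).
  have := ler0n R i; set x : R := i%:R => x0.
  have -> : ((x + 1)^-1 - (x + 1 + 1)^-1 = (x + 1)^-1 * (x + 1 + 1)^-1)%R.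
    by field; lra.
  rewrite expr2 mulrCA ler_pM2l ?invr_gt0; last lra.
  rewrite -[leLHS]mul1r ler_pdivrMr; last lra.
  by rewrite mulrAC ler_pdivlMr; lra.
have h0 i : [set` predT] i -> (0 <= (harmonic i ^+ s : R)%:E).
  by move=> _; rewrite lee_fin harmonic_pow_ge0.
rewrite (@summable_nneseries_lim R predT)//.
  rewrite /zeta; congr (limn _)%:E; apply/funext => n.
  by apply: eq_bigr => i _; rewrite /= harmonicE exprVn.
rewrite /summable -nneseries_esum; last by move=> i _; exact: abse_ge0.
apply: (@le_lt_trans _ _
    (\sum_(i <oo) (2 * (harmonic i - harmonic i.+1) : R)%:E)).
  by apply: lee_nneseries => // i _; rewrite gee0_abs ?h0// lee_fin.
rewrite nneseriesZlR ?nneseries_telescope ?cvg_harmonic ?ltry//; last first.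
  by move=> i; rewrite subr_ge0 lef_pV2 ?posrE ?ltr0n// ler_nat.
exact: cvg_harmonic.
Qed.

End nonnegative_series.

(** * Sums weighted by the reciprocals of the variables *)

Section harmonic_sum.
Variable R : realType.
Implicit Types (g h : nat -> \bar R).
Local Open Scope ereal_scope.

(** The sum over positive m_1, ..., m_r of g (m_1 + ... + m_r) / (m_1 ... m_r),
unfolded one variable at a time ([esum_harmonic_sum]). *)
Fixpoint harmonic_sum r g : \bar R :=
  if r is r'.+1 then
    \sum_(i <oo) (harmonic i)%:E * harmonic_sum r' (fun n => g (i.+1 + n)%N)
  else g 0%N.

Lemma harmonic_sumS r g : harmonic_sum r.+1 g =
  \sum_(i <oo) (harmonic i)%:E * harmonic_sum r (fun n => g (i.+1 + n)%N).
Proof. by []. Qed.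

Lemma eq_harmonic_sum r g h : g =1 h -> harmonic_sum r g = harmonic_sum r h.
Proof. by move=> /funext ->. Qed.

Lemma harmonic_sum_ge0 r g : (forall n, 0 <= g n) -> 0 <= harmonic_sum r g.
Proof.
elim: r g => //= r IHr g g0; apply: nneseries_ge0 => i _ _.
by rewrite mule_ge0 ?IHr// lee_fin harmonic_ge0.
Qed.

Lemma harmonic_sum_nneseries r (G : nat -> nat -> \bar R) :
  (forall j n, 0 <= G j n) ->
  harmonic_sum r (fun n => \sum_(j <oo) G j n) =
  \sum_(j <oo) harmonic_sum r (G j).
Proof.
elim: r G => //= r IHr G G0; rewrite nneseries_interchange; last first.
  by move=> i j; rewrite mule_ge0 ?harmonic_sum_ge0// lee_fin harmonic_ge0.
apply: eq_nneseries => i.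
rewrite (IHr (fun j n => G j (i.+1 + n)%N))//.
by rewrite nneseriesZl// => j _; exact: harmonic_sum_ge0.
Qed.

Lemma harmonic_sumD r g h : (forall n, 0 <= g n) -> (forall n, 0 <= h n) ->
  harmonic_sum r (fun n => g n + h n) = harmonic_sum r g + harmonic_sum r h.
Proof.
elim: r g h => //= r IHr g h g0 h0.
rewrite -nneseriesD; first last.
- by move=> i _ _; rewrite mule_ge0 ?harmonic_sum_ge0// lee_fin harmonic_ge0.
- by move=> i _ _; rewrite mule_ge0 ?harmonic_sum_ge0// lee_fin harmonic_ge0.
apply: eq_nneseries => i.
rewrite (IHr (fun n => g (i.+1 + n)%N) (fun n => h (i.+1 + n)%N))//.
by rewrite ge0_muleDr// harmonic_sum_ge0.
Qed.

Lemma harmonic_sumZ r (c : R) g : (forall n, 0 <= g n) ->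
  harmonic_sum r (fun n => c%:E * g n) = c%:E * harmonic_sum r g.
Proof.
elim: r g => //= r IHr g g0; rewrite -nneseriesZl; last first.
  by move=> i _; rewrite mule_ge0 ?harmonic_sum_ge0// lee_fin harmonic_ge0.
apply: eq_nneseries => i.
by rewrite (IHr (fun n => g (i.+1 + n)%N))// muleCA.
Qed.

Lemma harmonic_sum_sum r m (G : nat -> nat -> \bar R) :
  (forall c n, 0 <= G c n) ->
  harmonic_sum r (fun n => \sum_(0 <= c < m) G c n) =
  \sum_(0 <= c < m) harmonic_sum r (G c).
Proof.
move=> G0; elim: m => [|m IHm].
  rewrite big_geq//; elim: r => [|r IHr] /=; first by rewrite big_geq.
  rewrite eseries0// => i _ _; rewrite -[RHS](mule0 (harmonic i)%:E) -{2}IHr.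
  congr (_ * _); apply: eq_harmonic_sum => n.
  by rewrite !big_geq.
rewrite big_nat_recr//= -IHm -harmonic_sumD//; last first.
  by move=> n; exact: sume_ge0.
by apply: eq_harmonic_sum => n; rewrite big_nat_recr.
Qed.

(** By symmetry, each of the r+1 summands m_j of the total contributes equally,
and m_j cancels the weight 1/m_j. The induction on [r] peels off the first
variable instead of invoking the symmetry. *)
Lemma harmonic_sum_total r h : (forall n, 0 <= h n) ->
  harmonic_sum r.+1 (fun n => n%:R%:E * h n) =
  r.+1%:R%:E * \sum_(i <oo) harmonic_sum r (fun n => h (i.+1 + n)%N).
Proof.
have cancel i (x : \bar R) : (harmonic i)%:E * (i.+1%:R%:E * x) = x.
  by rewrite muleA -EFinM harmonicE mulVf ?mul1e// pnatr_eq0.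
elim: r h => [|r IHr] h h0.
  by rewrite /= mul1e; apply: eq_nneseries => i; rewrite addn0 cancel.
have hs0 i : 0 <= harmonic_sum r.+1 (fun n => h (i.+1 + n)%N).
  exact: harmonic_sum_ge0.
transitivity (\sum_(i <oo) (harmonic_sum r.+1 (fun n => h (i.+1 + n)%N) +
   r.+1%:R%:E * \sum_(j <oo) (harmonic i)%:E *
     harmonic_sum r (fun n => h (i.+1 + (j.+1 + n))%N))).
  rewrite harmonic_sumS; apply: eq_nneseries => i.
  transitivity ((harmonic i)%:E *
      (i.+1%:R%:E * harmonic_sum r.+1 (fun n => h (i.+1 + n)%N) +
       r.+1%:R%:E * \sum_(j <oo)
         harmonic_sum r (fun n => h (i.+1 + (j.+1 + n))%N))).
    congr (_ * _).
    rewrite -(IHr (fun n => h (i.+1 + n)%N))// -harmonic_sumZ//.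
    rewrite -harmonic_sumD//; [|by move=> n; rewrite mule_ge0..].
    apply: eq_harmonic_sum => n.
    by rewrite natrD EFinD ge0_muleDl.
  have s0 : 0 <= \sum_(j <oo)
         harmonic_sum r (fun n => h (i.+1 + (j.+1 + n))%N).
    by apply: nneseries_ge0 => j _ _; exact: harmonic_sum_ge0.
  rewrite ge0_muleDr ?mule_ge0//.
  rewrite cancel; congr (_ + _); rewrite muleCA nneseriesZl// => j _.
  exact: harmonic_sum_ge0.
have t0 i j : 0 <= (harmonic i)%:E *
     harmonic_sum r (fun n => h (i.+1 + (j.+1 + n))%N).
  by rewrite mule_ge0 ?harmonic_sum_ge0// lee_fin harmonic_ge0.
rewrite nneseriesD//; last first.
  by move=> i _ _; rewrite mule_ge0//; apply: nneseries_ge0 => *; exact: t0.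
rewrite nneseriesZl; last by move=> i _; apply: nneseries_ge0 => *; exact: t0.
rewrite [X in _ + _ * X]nneseries_interchange//.
have -> : r.+2%:R%:E = 1 + r.+1%:R%:E :> \bar R.
  by rewrite -EFinD addrC natr1.
rewrite ge0_muleDl// mul1e; congr (_ + _ * _).
apply: eq_nneseries => j /=; apply: eq_nneseries => i; congr (_ * _).
by apply: eq_harmonic_sum => n; rewrite addnCA.
Qed.

(** The index [a] stands for the integer a+1, added to the r variables in the
last denominator. *)
Definition tornheim_tail r a : \bar R :=
  harmonic_sum r (fun n => (harmonic (n + a)%N)%:E).

(** Write 1/(n+a+1) as n times 1/(n(n+a+1)): [harmonic_sum_total] frees one
variable i from its weight, and (a+1)/(n(n+a+1)) = 1/n - 1/(n+a+1) then
telescopes along i with lag a+1. *)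
Lemma tornheim_tailS r a :
  a.+1%:R%:E * tornheim_tail r.+1 a =
  r.+1%:R%:E * \sum_(0 <= c < a.+1) tornheim_tail r c.
Proof.
(* At n = 0 the default 0^-1 = 0 makes [h] vanish; the total n is positive as
     soon as there is one variable, so this value is never summed. *)
pose h n : \bar R := (n%:R^-1 * harmonic (n + a))%:E.
have h0 n : 0 <= h n by rewrite lee_fin mulr_ge0 ?invr_ge0 ?harmonic_ge0.
have -> : tornheim_tail r.+1 a = harmonic_sum r.+1 (fun n => n%:R%:E * h n).
  rewrite /tornheim_tail /=; apply: eq_nneseries => i; congr (_ * _).
  apply: eq_harmonic_sum => n; rewrite /h -EFinM mulrA mulfV ?mul1r//.
rewrite harmonic_sum_total// muleCA; congr (_ * _).
rewrite -nneseriesZl; last by move=> i _; exact: harmonic_sum_ge0.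
transitivity (\sum_(i <oo) harmonic_sum r
    (fun n => (harmonic (i + n)%N - harmonic (i + a.+1 + n)%N)%:E)).
  apply: eq_nneseries => i; rewrite -harmonic_sumZ//.
  apply: eq_harmonic_sum => n; rewrite /h -EFinM !harmonicE; congr _%:E.
  have -> : ((i.+1 + n)%:R = i%:R + n%:R + 1 :> R)%R.
    by rewrite !natrD -natr1; ring.
  have -> : ((i.+1 + n + a).+1%:R = i%:R + n%:R + a%:R + 2 :> R)%R.
    by rewrite -natr1 !natrD -natr1; ring.
  have -> : ((i + a.+1 + n).+1%:R = i%:R + n%:R + a%:R + 2 :> R)%R.
    by rewrite -natr1 !natrD -natr1; ring.
  rewrite -natr1; have := ler0n R i; have := ler0n R n; have := ler0n R a.
  move=> a0 n0 i0; field.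
  by apply/andP; split; lra.
rewrite -harmonic_sum_nneseries; last first.
  move=> j n; rewrite lee_fin subr_ge0 lef_pV2 ?posrE ?ltr0n//.
  by rewrite ler_nat; lia.
rewrite -harmonic_sum_sum; last by move=> c n; rewrite lee_fin harmonic_ge0.
apply: eq_harmonic_sum => n.
have u0 : (fun i => harmonic (i + n)%N) @ \oo --> (0 : R)%R.
  by rewrite (cvg_shiftn n); exact: cvg_harmonic.
rewrite (nneseries_telescope_block (u := fun i => harmonic (i + n)%N) _ u0).
rewrite -sumEFin.
by under eq_bigr do rewrite addnC.
Qed.

End harmonic_sum.

(** * Logarithmic moments of the Beta integrand *)

Section log_moment.
Variable R : realType.

(** For q > 0 this is the integral over [0,1] of
t^n (1-t)^a (-log t)^(q-1) / (q-1)!, because the factor 1-t acts as a difference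
in n; for q = 0 it is the value of t^n (1-t)^a at t = 1. *)
Fixpoint log_moment (q n a : nat) : R :=
  if a is a'.+1 then log_moment q n a' - log_moment q n.+1 a'
  else harmonic n ^+ q.

Lemma log_momentS q n a :
  log_moment q n a.+1 = log_moment q n a - log_moment q n.+1 a.
Proof. by []. Qed.

Lemma log_moment0S n a : log_moment 0 n a.+1 = 0.
Proof.
elim: a n => [|a IHa] n; first by rewrite /= !expr0 subrr.
by rewrite log_momentS !IHa subrr.
Qed.

Lemma log_moment_parts0 q n :
  n.+1%:R * log_moment q.+1 n 0 = log_moment q n 0.
Proof. by rewrite /= exprS mulrA harmonicE mulfV ?mul1r// pnatr_eq0. Qed.

(** Integration by parts: differentiating (1-t)^(a+1) gives the first term on
the right, and differentiating the power of the logarithm gives the second. *)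
Lemma log_moment_partsS q n a :
  n.+1%:R * log_moment q.+1 n a.+1 =
  a.+1%:R * log_moment q.+1 n.+1 a + log_moment q n a.+1.
Proof.
elim: a n => [|a IHa] n.
  rewrite !log_momentS mulrBr log_moment_parts0.
  by rewrite -(log_moment_parts0 q n.+1) -(natr1 n.+1); ring.
rewrite 2!log_momentS mulrBr IHa (log_momentS q n) (log_momentS q.+1 n.+1).
have := IHa n.+1; rewrite -(natr1 n.+1) -(natr1 a.+1) !log_momentS => E.
have {}E : n.+1%:R * (log_moment q.+1 n.+1 a - log_moment q.+1 n.+2 a) =
  a.+1%:R * log_moment q.+1 n.+2 a +
  (log_moment q n.+1 a - log_moment q n.+2 a)
  - (log_moment q.+1 n.+1 a - log_moment q.+1 n.+2 a).
  by rewrite -E; ring.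
by rewrite E; ring.
Qed.

Lemma log_moment_ge0 q n a : 0 <= log_moment q n a.
Proof.
elim: q n a => [|q IHq] n a.
  by case: a => [|a]; rewrite ?log_moment0S//= expr0 ler01.
elim: a n => [|a IHa] n; first exact: harmonic_pow_ge0.
rewrite -(pmulr_rge0 _ (ltr0Sn R n)) log_moment_partsS.
by rewrite addr_ge0// mulr_ge0.
Qed.

Lemma cvg_log_moment q a : (fun n => log_moment q.+1 n a) @ \oo --> (0 : R).
Proof.
elim: a => [|a IHa] /=.
  apply: (squeeze_cvgr (f := fun=> 0) _ (@cvg_cst _ _ _ _ _)
    (@cvg_harmonic R)).
  apply: nearW => n; rewrite harmonic_pow_ge0/= exprS.
  by rewrite ler_piMr ?harmonic_ge0// exprn_ile1 ?harmonic_ge0 ?harmonic_le1.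
rewrite -[X in _ --> X](subrr (0 : R)).
by apply: cvgB => //; rewrite (cvg_shiftS (fun n => log_moment q.+1 n a)).
Qed.

(** The case n = 0 of integration by parts expresses
(a+1) times the moment of exponent q+1 as a partial sum, so that raising [q]
takes arithmetic means. *)
Lemma log_moment_mean q a :
  a.+1%:R * log_moment q.+1 0 a = \sum_(0 <= b < a.+1) log_moment q 0 b.
Proof.
elim: a => [|a IHa].
  rewrite big_nat1; exact: log_moment_parts0.
rewrite big_nat_recr//= -IHa -(natr1 a.+1).
have := log_moment_partsS q 0 a; rewrite !log_momentS mul1r => E.
have {}E : log_moment q 0 a - log_moment q 1 a = log_moment q.+1 0 a
    - log_moment q.+1 1 a - a.+1%:R * log_moment q.+1 1 a by rewrite E; ring.
by rewrite E; ring.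
Qed.

(** For n = 0 each step in [q] is a Cesaro mean, which preserves the limit 0,
and the moments decrease with n. *)
Lemma cvg_log_moment_diff q n : log_moment q.+1 n @ \oo --> (0 : R).
Proof.
have : log_moment q.+1 0 @ \oo --> (0 : R).
  elim: q => [|q IHq].
    apply: cvg_trans (@cvg_harmonic R).
    apply: near_eq_cvg; apply: nearW => a; apply: (@mulfI _ a.+1%:R).
      by rewrite pnatr_eq0.
    rewrite log_moment_mean big_nat_recl//= expr0 big1 ?addr0.
      by rewrite harmonicE mulfV// pnatr_eq0.
    by move=> i _; rewrite -log_momentS log_moment0S.
  have := cesaro IHq; apply: cvg_trans; apply: near_eq_cvg.
  apply: nearW => a; rewrite /arithmetic_mean /series /= -log_moment_mean.
  by rewrite mulrA mulVf ?mul1r// pnatr_eq0.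
elim: n => // n IHn /IHn; apply: squeeze_cvgr; last exact: cvg_cst.
apply: nearW => a; rewrite log_moment_ge0/= -subr_ge0 -log_momentS.
exact: log_moment_ge0.
Qed.

(** Both sides satisfy the same recursion of arithmetic means, by
[tornheim_tailS] and [log_moment_mean]. *)
Lemma tornheim_tailE r a :
  tornheim_tail R r a = (r`!%:R * log_moment r.+1 0 a)%:E.
Proof.
have cancel (c : nat) (x y : \bar R) :
    (c.+1%:R%:E * x = c.+1%:R%:E * y -> x = y)%E.
  move=> /(congr1 (fun z => (c.+1%:R^-1)%:E * z)%E).
  by rewrite !muleA -!EFinM mulVf ?pnatr_eq0// !mul1e.
elim: r a => [|r IHr] a; apply: (cancel a).
  rewrite /tornheim_tail /= add0n mul1r -!EFinM log_moment_mean.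
  rewrite big_nat_recl//= expr0 big1 ?addr0.
    by rewrite harmonicE mulfV// pnatr_eq0.
  by move=> i _; rewrite -log_momentS log_moment0S.
rewrite tornheim_tailS -EFinM mulrCA log_moment_mean factS natrM -mulrA EFinM.
by congr (_ * _)%E; rewrite mulr_sumr -sumEFin; apply: eq_bigr => c _.
Qed.

(** Iterating [log_moment_partsS] until the exponent 0 is reached, where the
moment of a positive order of difference vanishes. *)
Lemma log_moment_expand q n a : log_moment q.+1 n a.+1 =
  a.+1%:R * \sum_(i < q.+1) harmonic n ^+ i.+1 * log_moment (q - i).+1 n.+1 a.
Proof.
apply: (@mulfI _ n.+1%:R); first by rewrite pnatr_eq0.
elim: q => [|q IHq]; rewrite log_moment_partsS mulrCA big_ord_recl subn0 expr1.
  rewrite big_ord0 addr0 log_moment0S addr0; congr (_ * _).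
  by rewrite mulrA harmonicE mulfV ?mul1r// pnatr_eq0.
rewrite mulrDr (mulrA n.+1%:R) harmonicE mulfV ?mul1r ?pnatr_eq0//.
rewrite mulrDr; congr (_ + _).
apply: (@mulfI _ n.+1%:R); first by rewrite pnatr_eq0.
rewrite IHq !mulr_sumr; apply: eq_bigr => i _.
rewrite /= /bump /= add1n subSS (exprS _ i.+1).
have : n.+1%:R != 0 :> R by rewrite pnatr_eq0.
by rewrite harmonicE; move: (n.+1%:R : R) => x x0; field.
Qed.

Local Open Scope ereal_scope.

Lemma nneseries_log_moment q n :
  \sum_(a <oo) (log_moment q.+1 n.+1 a)%:E = (harmonic n ^+ q.+1)%:E.
Proof.
rewrite -(nneseries_telescope (cvg_log_moment_diff q n)).
by apply: eq_nneseries => a; rewrite log_momentS; congr _%:E; ring.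
Qed.

(** The moment is the telescoping sum over n >= l of the next differences,
and each of these carries the factor a+1 by [log_moment_expand]: the factor
[harmonic a] is exchanged for a new summation variable n = l + m. *)
Lemma log_moment_transport q l a :
  (harmonic a * log_moment q.+1 l a)%:E =
  \sum_(m <oo) (\sum_(i < q.+1) harmonic (l + m)%N ^+ i.+1 *
     log_moment (q - i).+1 (l + m).+1 a)%:E.
Proof.
rewrite mulrC -[in LHS](addn0 l).
have := nneseries_telescope
  (u := fun m => (log_moment q.+1 (l + m) a * harmonic a)%R).
move=> <-; last first.
  rewrite -[X in _ --> X](mul0r (harmonic a : R)).
  apply: cvgM; last exact: cvg_cst.
  have := cvg_log_moment q a; rewrite -(cvg_shiftn l).
  by apply: cvg_trans; apply: near_eq_cvg; apply: nearW => m /=; rewrite addnC.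
apply: eq_nneseries => m; congr _%:E.
rewrite -mulrBl addnS -log_momentS log_moment_expand harmonicE.
by rewrite mulrAC mulfV ?mul1r// pnatr_eq0.
Qed.

Lemma nneseries_harmonic_log_moment q l :
  \sum_(a <oo) (harmonic a * log_moment q.+1 l a)%:E =
  \sum_(m <oo) (q.+1%:R * harmonic (l + m)%N ^+ q.+2)%:E.
Proof.
under eq_nneseries do rewrite log_moment_transport.
rewrite nneseries_interchange; last first.
  move=> a m; rewrite lee_fin sumr_ge0// => i _.
  by rewrite mulr_ge0 ?harmonic_pow_ge0 ?log_moment_ge0.
apply: eq_nneseries => m.
under eq_nneseries do rewrite -sumEFin.
rewrite nneseries_sum; last first.
  by move=> i a _; rewrite lee_fin mulr_ge0 ?harmonic_pow_ge0 ?log_moment_ge0.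
transitivity (\sum_(i < q.+1) (harmonic (l + m)%N ^+ q.+2 : R)%:E).
  apply: eq_bigr => i _; rewrite nneseriesZlR ?nneseries_log_moment; last first.
    by move=> a; rewrite log_moment_ge0.
  rewrite -EFinM -exprD; congr (_ ^+ _)%:E.
  by have := ltn_ord i; lia.
by rewrite sumEFin sumr_const card_ord mulr_natl.
Qed.

End log_moment.

(** The coefficient of z^q in 1/((1/u - z) (1/v - z)^2). *)
Definition weighted_power_sum (R : realType) q (u v : R) : R :=
  \sum_(i < q.+1) (q - i).+1%:R * u ^+ i.+1 * v ^+ (q - i).+2.

Lemma weighted_power_sum_ge0 (R : realType) q (u v : R) : 0 <= u -> 0 <= v ->
  0 <= weighted_power_sum q u v.
Proof. move=> u0 v0; rewrite /weighted_power_sum; apply: sumr_ge0 => i _.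
by apply: mulr_ge0; [apply: mulr_ge0|]; rewrite ?exprn_ge0. Qed.

(** Two transports, one for each factor of [harmonic a ^+ 2], produce the two
variables l < n = l + m + 1; the remaining sum over [a] is a pure power of
[harmonic n] for each of the ways to distribute the exponents, which is the
origin of the weights. *)
Lemma nneseries_harmonic2_log_moment (R : realType) q :
  (\sum_(a <oo) (harmonic a ^+ 2 * log_moment R q.+1 0 a)%:E =
   \sum_(l <oo) \sum_(m <oo)
     (weighted_power_sum q (harmonic l) (harmonic (l + m).+1))%:E)%E.
Proof.
pose G (l m a : nat) : R := (\sum_(i < q.+1) harmonic l ^+ i.+1 *
     (harmonic a * log_moment R (q - i).+1 l.+1 a)).
have G0 l m a : 0 <= G l m a.
  rewrite sumr_ge0// => i _.
  by rewrite !mulr_ge0 ?harmonic_pow_ge0 ?log_moment_ge0 ?harmonic_ge0.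
transitivity (\sum_(a <oo) \sum_(l <oo) (G l 0%N a)%:E)%E.
  apply: eq_nneseries => a; rewrite expr2 -mulrA EFinM log_moment_transport.
  rewrite -nneseriesZlR; last first.
    move=> m; rewrite sumr_ge0// => i _.
    by rewrite mulr_ge0 ?harmonic_pow_ge0 ?log_moment_ge0.
  apply: eq_nneseries => l; congr _%:E; rewrite mulr_sumr.
  apply: eq_bigr => i _.
  by rewrite add0n mulrCA.
rewrite nneseries_interchange; last by move=> *; rewrite lee_fin.
apply: eq_nneseries => l.
under eq_nneseries do rewrite -sumEFin.
rewrite nneseries_sum; last first.
  move=> i a _; rewrite lee_fin.
  by rewrite !mulr_ge0 ?harmonic_pow_ge0 ?log_moment_ge0 ?harmonic_ge0.
rewrite /weighted_power_sum.
under [RHS]eq_nneseries do rewrite -sumEFin.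
rewrite nneseries_sum; last first.
  move=> i a _; rewrite lee_fin.
  by apply: mulr_ge0; [apply: mulr_ge0|]; rewrite ?harmonic_pow_ge0.
apply: eq_bigr => i _; rewrite nneseriesZlR; last first.
  by move=> a; rewrite mulr_ge0 ?harmonic_ge0 ?log_moment_ge0.
rewrite nneseries_harmonic_log_moment -nneseriesZlR; last first.
  by move=> m; rewrite mulr_ge0 ?harmonic_pow_ge0.
by apply: eq_nneseries => m; rewrite mulrCA mulrA addSn.
Qed.

(** * Sums over tuples of positive integers *)

Section positive_tuples.
Variable R : realType.
Local Open Scope ereal_scope.

Definition positive_tuples r : set {ffun 'I_r -> nat} :=
  [set m | forall i, (0 < m i)%N].

Definition ffun_cons r (x : nat) (m : {ffun 'I_r -> nat}) :
    {ffun 'I_r.+1 -> nat} :=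
  [ffun j => oapp m x (unlift ord0 j)].

Lemma ffun_cons0 r x (m : {ffun 'I_r -> nat}) : ffun_cons x m ord0 = x.
Proof. by rewrite ffunE unlift_none. Qed.

Lemma ffun_cons_lift r x (m : {ffun 'I_r -> nat}) j :
  ffun_cons x m (lift ord0 j) = m j.
Proof. by rewrite ffunE liftK. Qed.

Lemma esum_positive_tuplesS r (F : {ffun 'I_r.+1 -> nat} -> \bar R) :
  (forall m, 0 <= F m) ->
  \esum_(m in @positive_tuples r.+1) F m =
  \sum_(x <oo) \esum_(m in @positive_tuples r) F (ffun_cons x.+1 m).
Proof.
move=> F0; rewrite nneseries_esumT; last by move=> x; exact: esum_ge0.
rewrite esum_esum//.
apply: (@reindex_esum _ _ _ _ _ (fun k => ffun_cons k.1.+1 k.2)).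
split.
- move=> [x m] [_ /= mpos] j; case: (unliftP ord0 j) => [i|] ->.
    by rewrite ffun_cons_lift.
  by rewrite ffun_cons0.
- move=> [x m] [y n] _ _ /= eq_xy; congr pair.
    have := congr1 (fun f : {ffun _} => f ord0) eq_xy.
    by rewrite !ffun_cons0 => -[].
  apply/ffunP => j.
  have := congr1 (fun f : {ffun _} => f (lift ord0 j)) eq_xy.
  by rewrite !ffun_cons_lift.
- move=> m mpos.
  exists ((m ord0).-1, [ffun j => m (lift ord0 j)]) => /=.
    by split => // j; rewrite ffunE.
  apply/ffunP => j; case: (unliftP ord0 j) => [i|] ->.
    by rewrite ffun_cons_lift ffunE.
  by rewrite ffun_cons0 prednK.
Qed.

(** The inequality from left to right bounds finite partial sums; applied to the
inverse constant it gives the other one. *)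
Lemma esumZl (T : choiceType) (P : set T) (c : R) (f : T -> \bar R) :
  (0 < c)%R -> (forall t, 0 <= f t) ->
  \esum_(t in P) (c%:E * f t) = c%:E * \esum_(t in P) f t.
Proof.
have le_esumZ (d : R) (g : T -> \bar R) : (0 < d)%R -> (forall t, 0 <= g t) ->
    \esum_(t in P) (d%:E * g t) <= d%:E * \esum_(t in P) g t.
  move=> d0 g0; apply: ge_ereal_sup => _ [A PA <-].
  rewrite -ge0_mule_fsumr// lee_pmul2l//.
  by apply: esum_ge; exists A.
move=> c0 f0; apply/eqP; rewrite eq_le le_esumZ//=.
have cf0 t : 0 <= c%:E * f t by rewrite mule_ge0// lee_fin ltW.
have ic0 : (0 < c^-1)%R by rewrite invr_gt0.
have := le_esumZ _ _ ic0 cf0.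
rewrite -(@lee_pmul2l _ c%:E)// muleA -EFinM mulfV ?gt_eqF// mul1e.
apply: le_trans; rewrite lee_pmul2l//; apply: le_esum => t _.
by rewrite muleA -EFinM mulVf ?gt_eqF// mul1e.
Qed.

Lemma esum_harmonic_sum r (g : nat -> \bar R) : (forall n, 0 <= g n) ->
  \esum_(m in @positive_tuples r)
    ((\prod_(i < r) (m i)%:R)^-1%:E * g (\sum_(i < r) m i)%N) =
  harmonic_sum r g.
Proof.
elim: r g => [|r IHr] g g0.
  rewrite (_ : @positive_tuples 0 = [set [ffun=> 0%N]]); last first.
    apply/seteqP; split => [m _|m _ [] //]; apply/ffunP => -[] //.
  by rewrite esum_set1 !big_ord0 invr1 mul1e.
rewrite esum_positive_tuplesS; last first.
  by move=> m; rewrite mule_ge0// lee_fin invr_ge0 prodr_ge0.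
rewrite harmonic_sumS; apply: eq_nneseries => x.
rewrite -(IHr (fun n => g (x.+1 + n)%N))//.
rewrite -esumZl ?harmonic_gt0//; last first.
  by move=> m; rewrite mule_ge0// lee_fin invr_ge0 prodr_ge0.
apply: eq_esum => m _.
rewrite !big_ord_recl ffun_cons0 invfM EFinM -muleA harmonicE.
congr (_ * (_ * _)).
  by congr (_^-1%:E); apply: eq_bigr => i _; rewrite ffun_cons_lift.
by congr (g (_ + _)%N); apply: eq_bigr => i _; rewrite ffun_cons_lift.
Qed.
End positive_tuples.

Lemma zeta_MT_double_sum (R : realType) p :
  (zeta_MT R p.+1 [tuple of 2%N :: nseq p 1%N] 1 =
   p`!%:R%:E * \sum_(l <oo) \sum_(m <oo)
     (weighted_power_sum p (harmonic l) (harmonic (l + m).+1))%:E)%E.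
Proof.
rewrite -nneseries_harmonic2_log_moment -nneseriesZlR; last first.
  by move=> a; rewrite mulr_ge0 ?harmonic_pow_ge0 ?log_moment_ge0.
rewrite /zeta_MT (esum_positive_tuplesS (r := p)); last first.
  move=> m; rewrite lee_fin invr_ge0 mulr_ge0 ?exprn_ge0 ?sumr_ge0 ?prodr_ge0//.
apply: eq_nneseries => a.
transitivity ((harmonic a ^+ 2)%:E * tornheim_tail R p a)%E; last first.
  by rewrite tornheim_tailE -EFinM mulrCA.
rewrite /tornheim_tail -esum_harmonic_sum; last first.
  by move=> n; rewrite lee_fin harmonic_ge0.
rewrite -esumZl ?exprn_gt0 ?harmonic_gt0//; last first.
  by move=> m; rewrite mule_ge0// lee_fin ?harmonic_ge0// invr_ge0 prodr_ge0.
apply: eq_esum => m _.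
rewrite -!EFinM !big_ord_recl ffun_cons0 tnth0; congr _%:E.
rewrite expr1 !invfM harmonicE -mulrA; congr (_ * (_^-1 * _)).
  apply: eq_bigr => i _; rewrite ffun_cons_lift tnthS.
  by rewrite (tnth_nth 0%N)/= nth_nseq ltn_ord expr1.
congr _^-1; rewrite -addnS addnC natrD; congr (_ + _); rewrite natr_sum.
by apply: eq_bigr => i _; rewrite ffun_cons_lift.
Qed.

(** * Double series *)

Section double_series.
Variable R : realType.
Implicit Types (F G : nat -> nat -> R) (u v : nat -> R).
Local Open Scope ereal_scope.

Definition dseries F : \bar R := \sum_(i <oo) \sum_(j <oo) (F i j)%:E.

Lemma eq_dseries F G : (forall i j, F i j = G i j) -> dseries F = dseries G.
Proof.
by move=> FG; apply: eq_nneseries => i; apply: eq_nneseries => j; rewrite FG.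
Qed.

Lemma dseries_ge0 F : (forall i j, 0 <= F i j)%R -> 0 <= dseries F.
Proof.
move=> F0; apply: nneseries_ge0 => i _ _; apply: nneseries_ge0 => j _ _.
by rewrite lee_fin.
Qed.

Lemma dseriesD F G : (forall i j, 0 <= F i j)%R -> (forall i j, 0 <= G i j)%R ->
  dseries (fun i j => F i j + G i j)%R = dseries F + dseries G.
Proof.
move=> F0 G0; rewrite /dseries -nneseriesD; first last.
- by move=> i _ _; apply: nneseries_ge0 => j _ _; rewrite lee_fin.
- by move=> i _ _; apply: nneseries_ge0 => j _ _; rewrite lee_fin.
by apply: eq_nneseries => i; rewrite -nneseriesD// => j _ _; rewrite lee_fin.
Qed.

Lemma dseriesZ (c : R) F : (forall i j, 0 <= F i j)%R ->
  dseries (fun i j => c * F i j)%R = c%:E * dseries F.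
Proof.
move=> F0; rewrite /dseries -nneseriesZl; last first.
  by move=> i _; apply: nneseries_ge0 => j _ _; rewrite lee_fin.
by apply: eq_nneseries => i; rewrite nneseriesZlR.
Qed.

Lemma dseriesC F : (forall i j, 0 <= F i j)%R ->
  dseries (fun i j => F j i) = dseries F.
Proof.
move=> F0; rewrite /dseries nneseries_interchange// => i j.
by rewrite lee_fin.
Qed.

Lemma dseries_triangle F : (forall i j, 0 <= F i j)%R ->
  dseries (fun i m => F i (i + m).+1) =
  \sum_(n <oo) (\sum_(0 <= i < n) F i n)%:E.
Proof.
move=> F0; rewrite /dseries.
rewrite (nneseries_lt_triangle (F := fun i j => (F i j)%:E)).
  by apply: eq_nneseries => n; rewrite sumEFin.
by move=> i j; rewrite lee_fin.
Qed.

Lemma dseries_diagonal F : (forall i j, 0 <= F i j)%R ->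
  dseries F = \sum_(i <oo) (F i i)%:E + dseries (fun i m => F i (i + m).+1)
  + dseries (fun i m => F (i + m).+1 i).
Proof.
move=> F0; rewrite /dseries.
exact: (nneseries_split_diagonal (F := fun i j => (F i j)%:E)).
Qed.

Lemma dseries_prod u v (s t : R) :
  (forall i, 0 <= u i)%R -> (forall i, 0 <= v i)%R ->
  \sum_(i <oo) (u i)%:E = s%:E -> \sum_(i <oo) (v i)%:E = t%:E ->
  dseries (fun i j => u i * v j)%R = (s * t)%:E.
Proof.
move=> u0 v0 us vt; rewrite mulrC EFinM -us -nneseriesZlR//.
by apply: eq_nneseries => i; rewrite nneseriesZlR// vt mulrC EFinM.
Qed.

Lemma dseries_sum k (F : nat -> nat -> nat -> R) :
  (forall n i j, 0 <= F n i j)%R ->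
  dseries (fun i j => \sum_(n < k) F n i j)%R = \sum_(n < k) dseries (F n).
Proof.
move=> F0; elim: k => [|k IHk].
  rewrite big_ord0 /dseries eseries0// => i _ _.
  by rewrite eseries0// => j _ _; rewrite big_ord0.
rewrite big_ord_recr/= -IHk -dseriesD//; last by move=> *; exact: sumr_ge0.
by apply: eq_dseries => i j; rewrite big_ord_recr.
Qed.

End double_series.

(** * Partial fraction identities *)

Section finite_identities.
Variable R : realType.
Implicit Types (u v d s : R) (q k : nat).

Lemma harmonic_sub l m : harmonic m * (harmonic l - harmonic (l + m).+1)
  = harmonic l * harmonic (l + m).+1 :> R.
Proof.
rewrite !harmonicE -(natr1 (l + m).+1) -(natr1 (l + m)) -(natr1 l) -(natr1 m).
rewrite natrD.
have := ler0n R l; have := ler0n R m; move=> *; field.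
by apply/and3P; split; lra.
Qed.

Lemma harmonic_add l n : harmonic (l + n).+1 * (harmonic l + harmonic n)
  = harmonic l * harmonic n :> R.
Proof.
rewrite !harmonicE -(natr1 (l + n).+1) -(natr1 (l + n)) -(natr1 l) -(natr1 n).
rewrite natrD.
have := ler0n R l; have := ler0n R n; move=> *; field.
by apply/and3P; split; lra.
Qed.

(** For u = 1/l, v = 1/n the relation between [d], [u] and [v] says that
d = 1/(n-l); the identity is then the z^p coefficient of the partial fraction
expansion of 1/((l-z)(n-z)^2). It is arranged with positive terms only, so that
it can be summed in the extended reals. *)
Lemma weighted_power_sumE p u v d : d * (u - v) = u * v ->
  weighted_power_sum p u v + p.+1%:R * (d * v ^+ p.+2) + d ^+ 2 * v ^+ p.+1 =
  d ^+ 2 * u ^+ p.+1.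
Proof.
move=> E; have {}E : d * (u - v) - u * v = 0 by rewrite E subrr.
elim: p => [|p IHp].
  apply/eqP; rewrite -subr_eq0 /weighted_power_sum big_ord1 subn0.
  rewrite [X in X == _](_ : _ = - (d + v) * (d * (u - v) - u * v)).
    by rewrite E mulr0.
  by ring.
have -> : weighted_power_sum p.+1 u v =
    p.+2%:R * u * v ^+ p.+3 + u * weighted_power_sum p u v.
  rewrite /weighted_power_sum big_ord_recl subn0 expr1; congr (_ + _).
  rewrite mulr_sumr; apply: eq_bigr => i _.
  by rewrite /= /bump /= add1n subSS (exprS _ i.+1); ring.
have -> : weighted_power_sum p u v = d ^+ 2 * u ^+ p.+1 -
    p.+1%:R * (d * v ^+ p.+2) - d ^+ 2 * v ^+ p.+1 by rewrite -IHp; ring.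
apply/eqP; rewrite -subr_eq0 -(natr1 p.+1).
rewrite (exprS v p.+2) (exprS v p.+1) (exprS u p.+1).
rewrite [X in X == _](_ : _ =
  - (d * v ^+ p.+1 + (p.+1%:R + 1) * (v * v ^+ p.+1)) *
  (d * (u - v) - u * v)); last by ring.
by rewrite E mulr0.
Qed.

(** With u = 1/a and v = 1/b, the sum over all pairs (a,b) of this expression is
the sum over n = 1, ..., k of (2k+1-2n) zeta(2n+1) zeta(2k+2-2n), the index
being i = n-1; see [dseries_parity_sum]. *)
Definition parity_sum k u v : R :=
  \sum_(i < k) (2 * (k - i) - 1)%:R * u ^+ (2 * i + 3) * v ^+ (2 * (k - i)).

Lemma parity_sum_ge0 k u v : 0 <= u -> 0 <= v -> 0 <= parity_sum k u v.
Proof.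
move=> u0 v0; rewrite /parity_sum; apply: sumr_ge0 => i _.
by apply: mulr_ge0; [apply: mulr_ge0|]; rewrite ?exprn_ge0.
Qed.

Lemma parity_sumS k u v : parity_sum k.+1 u v =
  (2 * k + 1)%:R * u ^+ 3 * v ^+ (2 * k + 2) + u ^+ 2 * parity_sum k u v.
Proof.
rewrite /parity_sum big_ord_recl subn0.
congr (_%:R * _ * _ ^+ _ + _); [lia|lia|].
rewrite mulr_sumr; apply: eq_bigr => i _.
rewrite /= /bump /= add1n subSS.
have -> : (2 * i.+1 + 3 = 2 + (2 * i + 3))%N by lia.
by rewrite exprD; ring.
Qed.

Lemma parity_sum_diag k u : parity_sum k u u = k%:R ^+ 2 * u ^+ (2 * k + 3).
Proof.
elim: k => [|k IHk]; first by rewrite /parity_sum big_ord0 expr0n/= mul0r.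
rewrite parity_sumS IHk.
have -> : (2 * k.+1 + 3 = 3 + (2 * k + 2))%N by lia.
have -> : (2 * k + 3 = 1 + (2 * k + 2))%N by lia.
by rewrite !(exprD u) natrD natrM -(natr1 k); ring.
Qed.

(** For u = 1/l and v = 1/n the hypotheses say d = 1/(n-l) and s = 1/(n+l).
The left side is, up to the factor 2, the z^(2k) coefficient of the product of
the even function (1/(l-z) + 1/(l+z))/2 - 1/l and the even function
(1/(n-z)^2 + 1/(n+z)^2)/2; the right side expands that product in partial
fractions. *)
Lemma parity_sumE k u v d s : u != v -> u + v != 0 ->
  d * (u - v) = u * v -> s * (u + v) = u * v ->
  2 * parity_sum k u v =
  (2 * k + 1)%:R * v ^+ (2 * k + 2) * (s - d - 2 * u)
  + u ^+ (2 * k + 1) * (d ^+ 2 + s ^+ 2) + v ^+ (2 * k + 1) * (s ^+ 2 - d ^+ 2).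
Proof.
rewrite -subr_eq0 => uv uv' Ed Es.
have -> : d = u * v / (u - v) by rewrite -Ed mulfK.
have -> : s = u * v / (u + v) by rewrite -Es mulfK.
elim: k => [|k IHk].
  rewrite /parity_sum big_ord0 muln0 !add0n; field.
  by rewrite uv uv'.
rewrite parity_sumS mulrDr [2 * (u ^+ 2 * _)]mulrCA IHk.
have -> : (2 * k.+1 + 2 = 2 * k + 4)%N by lia.
have -> : (2 * k.+1 + 1 = 2 * k + 3)%N by lia.
rewrite !exprD !natrD; field.
by rewrite uv uv'.
Qed.

(** Exchanging [u] and [v] changes the sign of [d], so the terms in d^2 cancel.
The remaining ones are grouped and distributed over the two sides so that each
group is nonnegative for l < n. *)
Lemma parity_sum_sym k u v d s : u != v -> u + v != 0 ->
  d * (u - v) = u * v -> s * (u + v) = u * v ->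
  2 * (parity_sum k u v + parity_sum k v u)
  + (2 * k + 1)%:R * (v ^+ (2 * k + 2) * (d + 2 * u - s)) =
  (2 * k + 1)%:R * (u ^+ (2 * k + 2) * (d + s - 2 * v))
  + 2 * (u ^+ (2 * k + 1) * s ^+ 2 + v ^+ (2 * k + 1) * s ^+ 2).
Proof.
move=> uv uv' Ed Es; rewrite mulrDr.
rewrite (parity_sumE k uv uv' Ed Es) (@parity_sumE k v u (- d) s).
- by ring.
- by rewrite eq_sym.
- by rewrite addrC.
- by rewrite mulNr -mulrN opprB mulrC [RHS]mulrC -Ed mulrC.
- by rewrite addrC Es mulrC.
Qed.

End finite_identities.

(** * Evaluation of the double series *)

Section double_zeta_series.
Variable R : realType.
Implicit Types (q k l m n p : nat).
Local Open Scope ereal_scope.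

Local Notation h := (@harmonic R).

Let h0 i : (0 <= h i)%R. Proof. exact: harmonic_ge0. Qed.
Let hx0 i q : (0 <= h i ^+ q)%R. Proof. exact: harmonic_pow_ge0. Qed.

(** The double zeta value zeta(a,b), with [a] the exponent of the larger
variable n = l + m + 1. *)
Definition dzeta a b : \bar R :=
  dseries (fun l m => h l ^+ b * h (l + m).+1 ^+ a)%R.

(** The reflection l -> n-l of the smaller variable, which replaces it by the
gap, of index [m]. *)
Lemma dzeta1E a : dzeta a 1 = dseries (fun l m => h m * h (l + m).+1 ^+ a)%R.
Proof.
rewrite /dzeta -[RHS]dseriesC; last by move=> l m; rewrite mulr_ge0.
by apply: eq_dseries => l m; rewrite expr1 addnC.
Qed.

Lemma dzeta_stuffle a b : (2 <= a)%N -> (2 <= b)%N ->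
  (zeta R a * zeta R b)%:E = (zeta R (a + b))%:E + dzeta a b + dzeta b a.
Proof.
move=> a2 b2.
have := @dseries_prod R _ _ _ _ (hx0^~ b) (hx0^~ a) (zetaE R b2) (zetaE R a2).
rewrite dseries_diagonal; last by move=> i j; rewrite mulr_ge0.
rewrite [in RHS]mulrC => <-; congr (_ + _ + _).
  by rewrite -zetaE ?ltn_addl//; apply: eq_nneseries => i; rewrite -exprD addnC.
by apply: eq_dseries => i j; rewrite mulrC.
Qed.

(** For each n there are n terms below the diagonal, each at most
c/(n+1)^(q+1), so that the sum is at most c zeta(q). *)
Lemma triangle_fin_num (F : nat -> nat -> R) (c : R) q : (2 <= q)%N ->
  (forall i m, 0 <= F i (i + m).+1)%R ->
  (forall i m, F i (i + m).+1 <= c * h (i + m).+1 ^+ q.+1)%R ->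
  dseries (fun i m => F i (i + m).+1) \is a fin_num.
Proof.
move=> q2 F0 Fc.
have c0 : (0 <= c)%R.
  have := le_trans (F0 0%N 0%N) (Fc 0%N 0%N).
  by rewrite pmulr_lge0// exprn_gt0// harmonic_gt0.
have le0 : 0 <= dseries (fun i m => F i (i + m).+1) by exact: dseries_ge0.
rewrite fin_numElt (lt_le_trans (ltNyr 0%R))//=.
apply: (@le_lt_trans _ _ (c * zeta R q)%:E); last exact: ltry.
rewrite EFinM -zetaE// -nneseriesZlR//.
apply: (@le_trans _ _ (dseries (fun i m => c * h (i + m).+1 ^+ q.+1)%R)).
  apply: lee_nneseries => [i _ _|i _].
    by apply: nneseries_ge0 => m _ _; rewrite lee_fin.
  by apply: lee_nneseries => m _; rewrite lee_fin.
rewrite (dseries_triangle (F := fun i n => c * h n ^+ q.+1)%R); last first.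
  by move=> *; rewrite mulr_ge0.
apply: lee_nneseries => [n _ _|n _].
  by rewrite lee_fin sumr_ge0// => *; rewrite mulr_ge0.
rewrite lee_fin sumr_const_nat subn0 -mulr_natl mulrCA ler_wpM2l//.
rewrite exprS mulrA -[leRHS]mul1r ler_wpM2r// harmonicE ler_pdivrMr ?ltr0n//.
by rewrite mul1r ler_nat.
Qed.

Lemma dzeta1_fin a : (3 <= a)%N -> dzeta a 1 \is a fin_num.
Proof.
case: a => // a a2; rewrite /dzeta.
apply: (@triangle_fin_num (fun l n => h l ^+ 1 * h n ^+ a.+1)%R 1%R a) => //.
  by move=> *; rewrite mulr_ge0.
by move=> i m; rewrite ler_wpM2r// expr1 harmonic_le1.
Qed.

Lemma dzeta_fin a b : (2 <= a)%N -> (2 <= b)%N -> dzeta a b \is a fin_num.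
Proof.
move=> a2 b2; have : (zeta R a * zeta R b)%:E \is a fin_num by [].
by rewrite dzeta_stuffle// !fin_numD => /andP[/andP[]].
Qed.

(** Summing [weighted_power_sumE] over l < n, the right-hand side becomes
zeta(2) zeta(p+1), whose splitting along the diagonal contains zeta(p+1,2); this
term cancels the last one on the left. *)
Lemma dseries_weighted_power_sum p : (1 <= p)%N ->
  dseries (fun l m => weighted_power_sum p (h l) (h (l + m).+1)) =
  (zeta R p.+3 + fine (dzeta 2 p.+1) - p.+1%:R * fine (dzeta p.+2 1))%:E.
Proof.
move=> p1.
have wps0 l m : (0 <= weighted_power_sum p (h l) (h (l + m).+1))%R.
  exact: weighted_power_sum_ge0.
have E : dseries (fun l m => weighted_power_sum p (h l) (h (l + m).+1))
    + p.+1%:R%:E * dzeta p.+2 1 + dzeta p.+1 2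
    = (zeta R p.+3)%:E + dzeta 2 p.+1 + dzeta p.+1 2.
  have <- := @dzeta_stuffle 2 p.+1 isT p1.
  rewrite -(dseries_prod (hx0^~ 2%N) (hx0^~ p.+1)
    (@zetaE R 2 isT) (@zetaE R p.+1 p1)).
  rewrite -(dseriesC (F := fun i j => (h i ^+ 2 * h j ^+ p.+1)%R)); last first.
    by move=> i j; rewrite mulr_ge0.
  rewrite dzeta1E -dseriesZ; last by move=> l m; rewrite mulr_ge0.
  rewrite -dseriesD//; last by move=> l m; rewrite mulr_ge0// mulr_ge0.
  rewrite /dzeta.
  rewrite -(dseriesC (F := fun l m => (h l ^+ 2 * h (l + m).+1 ^+ p.+1)%R));
    last first.
    by move=> i j; rewrite mulr_ge0.
  rewrite -dseriesD; first last.
  - by move=> l m; rewrite mulr_ge0.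
  - by move=> l m; rewrite addr_ge0// mulr_ge0// mulr_ge0.
  apply: eq_dseries => l m; rewrite (addnC m l).
  exact/weighted_power_sumE/harmonic_sub.
have Z1 : dzeta p.+2 1 \is a fin_num by exact: dzeta1_fin.
have Z2 : dzeta 2 p.+1 \is a fin_num by exact: dzeta_fin.
have X : dzeta p.+1 2 \is a fin_num by exact: dzeta_fin.
move: E; set S := dseries _; move: Z1 Z2 X => /fineK <- /fineK <- /fineK <-.
rewrite -!EFinD -EFinM => E.
have S_fin : S \is a fin_num.
  have : S + (p.+1%:R * fine (dzeta p.+2 1))%:E + (fine (dzeta p.+1 2))%:E
    \is a fin_num by rewrite E.
  by rewrite !fin_numD => /andP[/andP[]].
move: E; rewrite -(fineK S_fin) -!EFinD => -[E]; congr _%:E.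
by rewrite /=; lra.
Qed.

(** The summand is the second difference, with lag l+1, of the harmonic
sequence at [m]. *)
Lemma nneseries_harmonic_second_difference l :
  \sum_(m <oo) (h m + h (l + (l + m).+1).+1 - 2 * h (l + m).+1)%:E =
  (\sum_(0 <= c < l.+1) (h c - h (c + l.+1)%N))%:E.
Proof.
rewrite -(nneseries_telescope_block
  (u := fun c => (h c - h (c + l.+1)%N)%R) l.+1).
  apply: eq_nneseries => m; congr _%:E.
  have -> : (m + l.+1 = (l + m).+1)%N by lia.
  have -> : ((l + m).+1 + l.+1 = (l + (l + m).+1).+1)%N by lia.
  by ring.
rewrite -[X in _ --> X](subrr (0%R : R)).
apply: cvgB; first exact: cvg_harmonic.
by rewrite (cvg_shiftn l.+1 h); exact: cvg_harmonic.
Qed.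

(** After removal of the common terms only [harmonic b] and
[harmonic (b + b.+1)] remain, and the latter is half of the former: this is
where the fraction 1/2 in [harmonic_second_difference_dseries] comes from. *)
Lemma harmonic_differences_balance b :
  (\sum_(0 <= c < b.+1) (h c - h (c + b.+1)%N) + 2 * \sum_(0 <= i < b) h i =
   \sum_(0 <= i < b) (h (b - i.+1)%N + 2 * h i - h (i + b).+1) + h b / 2)%R.
Proof.
rewrite sumrB !big_split /= sumrN big_nat_recr//= -mulr_sumr.
rewrite [X in (_ - X)%R]big_nat_recr//=.
have -> : (\sum_(0 <= i < b) h (b - i.+1)%N = \sum_(0 <= i < b) h i)%R.
  by rewrite [RHS]big_nat_rev.
have -> : (\sum_(0 <= i < b) h (i + b.+1)%N = \sum_(0 <= i < b) h (i + b).+1)%R.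
  by apply: eq_bigr => i _; rewrite addnS.
have -> : (h (b + b.+1)%N = h b / 2)%R.
  rewrite !harmonicE (_ : (b + b.+1).+1 = (2 * b.+1)%N); last by lia.
  by rewrite natrM invfM mulrC.
by lra.
Qed.

(** Convexity of the reciprocal. *)
Lemma harmonic_second_difference_ge0 l m :
  (0 <= h m + h (l + (l + m).+1).+1 - 2 * h (l + m).+1)%R.
Proof.
rewrite !harmonicE -(natr1 (l + (l + m).+1).+1) -(natr1 (l + (l + m).+1)) natrD.
rewrite -(natr1 (l + m).+1) -(natr1 (l + m)) natrD -(natr1 m).
have := ler0n R l; have := ler0n R m; move: (l%:R : R) (m%:R : R) => x y y0 x0.
rewrite [leRHS](_ : _ =
  2 * (x + 1) ^+ 2 / ((y + 1) * (x + y + 2) * (2 * x + y + 3)))%R.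
  by rewrite divr_ge0// ?mulr_ge0 ?exprn_ge0//; lra.
by field; apply/and3P; split; lra.
Qed.

(** The first double series is summed over n > l for fixed l, the other two over
l < n for fixed n; each inner sum is a combination of harmonic numbers, and
[harmonic_differences_balance] compares them. *)
Lemma harmonic_second_difference_dseries q : (2 <= q)%N ->
  dseries (fun l m => h l ^+ q.+1 *
    (h m + h (l + (l + m).+1).+1 - 2 * h (l + m).+1))%R
  + 2%:E * dzeta q.+1 1 =
  dseries (fun l m => h (l + m).+1 ^+ q.+1 *
     (h m + 2 * h l - h (l + (l + m).+1).+1))%R
  + (2^-1 * zeta R q.+2)%:E.
Proof.
move=> q2.
pose F l n := (h n ^+ q.+1 * (h (n - l.+1)%N + 2 * h l - h (l + n).+1))%R.
have F0 l n : (0 <= F l n)%R.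
  rewrite mulr_ge0// subr_ge0; apply: (@le_trans _ _ (h l)).
    by apply: harmonic_decr; lia.
  by have := h0 l; have := h0 (n - l.+1)%N; lra.
have -> : dseries (fun l m => h (l + m).+1 ^+ q.+1 *
     (h m + 2 * h l - h (l + (l + m).+1).+1))%R =
     dseries (fun l m => F l (l + m).+1).
  by apply: eq_dseries => l m; rewrite /F subSS addKn.
rewrite dseries_triangle// /dzeta.
rewrite (dseries_triangle (F := fun i n => (h i ^+ 1 * h n ^+ q.+1)%R));
  last first.
  by move=> *; rewrite mulr_ge0.
rewrite EFinM -(@zetaE R q.+2)// -!nneseriesZlR//; last first.
  by move=> n; rewrite sumr_ge0// => i _; rewrite mulr_ge0.
pose A l := (\sum_(0 <= c < l.+1) (h c - h (c + l.+1)%N))%R.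
have A0 l : (0 <= A l)%R.
  rewrite sumr_ge0// => c _; rewrite subr_ge0.
  by apply: harmonic_decr; lia.
transitivity (\sum_(l <oo) (h l ^+ q.+1 * A l)%:E +
   \sum_(i <oo) (2 * \sum_(0 <= l < i) (h l ^+ 1 * h i ^+ q.+1))%:E).
  congr (_ + _); apply: eq_nneseries => l.
  rewrite nneseriesZlR; last by move=> m; exact: harmonic_second_difference_ge0.
  by rewrite nneseries_harmonic_second_difference.
have sF0 n : (0 <= \sum_(0 <= i < n) F i n)%R by exact: sumr_ge0.
have sh0 n : (0 <= \sum_(0 <= i < n) h i ^+ 1 * h n ^+ q.+1)%R.
  by apply: sumr_ge0 => i _; rewrite mulr_ge0.
rewrite -!nneseriesDR//; [|by move=> n; rewrite mulr_ge0..].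
apply: eq_nneseries => n; congr _%:E.
rewrite -!mulr_suml -mulr_sumr.
under [X in (_ + 2 * (X * _))%R]eq_bigr do rewrite expr1.
have -> : (h n ^+ q.+2 = h n ^+ q.+1 * h n)%R by rewrite exprSr.
have := harmonic_differences_balance n; rewrite -/(A n) => E.
have {}E : A n = (\sum_(0 <= i < n) (h (n - i.+1)%N + 2 * h i - h (i + n).+1)
  + h n / 2 - 2 * \sum_(0 <= i < n) h i)%R by rewrite -E; ring.
by rewrite E; ring.
Qed.

(** In zeta(2,q) write the larger variable as the sum of the smaller one and of
another positive integer; the pairs obtained are split along the diagonal,
which contributes zeta(q+2)/4. *)
Lemma dzeta2_fold q : (1 <= q)%N ->
  dseries (fun l m => h l ^+ q * h (l + (l + m).+1).+1 ^+ 2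
     + h (l + m).+1 ^+ q * h (l + (l + m).+1).+1 ^+ 2)%R
  + (4^-1 * zeta R q.+2)%:E = dzeta 2 q.
Proof.
move=> q1.
rewrite [RHS](dseries_diagonal
  (F := fun i j => (h i ^+ q * h (i + j).+1 ^+ 2)%R)); last first.
  by move=> *; rewrite mulr_ge0.
rewrite dseriesD; [|by move=> *; rewrite mulr_ge0..].
rewrite addeC addeA; congr (_ + _ + _).
  rewrite EFinM -zetaE// -nneseriesZlR//; apply: eq_nneseries => i; congr _%:E.
  have -> : (h (i + i).+1 = h i / 2)%R.
    rewrite !harmonicE (_ : (i + i).+2 = (2 * i.+1)%N); last by lia.
    by rewrite natrM invfM mulrC.
  by rewrite -(addn2 q) exprD; field.
by apply: eq_dseries => l m; rewrite (addnC (l + m).+1).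
Qed.

(** [parity_sum_sym] summed over l < n relates the series to [P], [N] and [S];
the two preceding lemmas evaluate P - N and S. *)
Lemma dseries_parity_sum_off_diagonal k : (1 <= k)%N ->
  dseries (fun l m => parity_sum k (h l) (h (l + m).+1)
                      + parity_sum k (h (l + m).+1) (h l))%R =
  (fine (dzeta 2 (2 * k).+1) - (2 * k + 1)%:R * fine (dzeta (2 * k).+2 1)
   + k%:R / 2 * zeta R (2 * k).+3)%:E.
Proof.
move=> k1.
have q2 : (2 <= (2 * k).+1)%N by lia.
have q3 : (3 <= (2 * k).+2)%N by lia.
have N_ge0 l m : (0 <= h m + 2 * h l - h (l + (l + m).+1).+1)%R.
  have := @harmonic_decr R l (l + (l + m).+1).+1; have := h0 l; have := h0 m.
  by move=> ? ? /(_ ltac:(lia)); lra.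
set U := dseries _.
have := dzeta2_fold (q := (2 * k).+1) isT; set S := dseries _ => E3.
have := harmonic_second_difference_dseries q2.
set P := dseries _; set N := dseries _ => E2.
have U0 l m : (0 <= parity_sum k (h l) (h (l + m).+1)
                      + parity_sum k (h (l + m).+1) (h l))%R.
  by rewrite addr_ge0// parity_sum_ge0.
have E1 : 2%:E * U + (2 * k + 1)%:R%:E * N = (2 * k + 1)%:R%:E * P + 2%:E * S.
  have P0 l m : (0 <= h l ^+ (2 * k).+2 *
      (h m + h (l + (l + m).+1).+1 - 2 * h (l + m).+1))%R.
    by rewrite mulr_ge0// harmonic_second_difference_ge0.
  have S0 l m : (0 <= h l ^+ (2 * k).+1 * h (l + (l + m).+1).+1 ^+ 2
     + h (l + m).+1 ^+ (2 * k).+1 * h (l + (l + m).+1).+1 ^+ 2)%R.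
    by rewrite addr_ge0// mulr_ge0.
  have N0 l m : (0 <= h (l + m).+1 ^+ (2 * k).+2 *
     (h m + 2 * h l - h (l + (l + m).+1).+1))%R by rewrite mulr_ge0.
  rewrite /U /N /P /S -!dseriesZ// -!dseriesD//; last first.
  - by move=> l m; rewrite mulr_ge0.
  - by move=> l m; rewrite mulr_ge0.
  - by move=> l m; rewrite mulr_ge0.
  - by move=> l m; rewrite mulr_ge0.
  apply: eq_dseries => l m.
  have := @parity_sum_sym R k (h l) (h (l + m).+1) (h m)
    (h (l + (l + m).+1).+1).
  rewrite addn1 addn2; apply.
  - rewrite !harmonicE; apply/eqP => /invr_inj/eqP.
    by rewrite eqr_nat; lia.
  - by rewrite gt_eqF// addr_gt0// harmonic_gt0.
  - exact: harmonic_sub.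
  - exact: harmonic_add.
have Nfin : N \is a fin_num.
  pose F l n := (h n ^+ (2 * k).+2 *
     (h (n - l.+1)%N + 2 * h l - h (l + n).+1))%R.
  have -> : N = dseries (fun l m => F l (l + m).+1).
    by apply: eq_dseries => l m; rewrite /F subSS addKn.
  apply: (@triangle_fin_num F 3%R (2 * k).+1) => // l m.
    rewrite /F subSS addKn.
    by rewrite mulr_ge0.
  rewrite /F subSS addKn mulrC ler_wpM2r//.
  (* The bound 3 is 1 + 2, each reciprocal being at most 1. *)
  have := harmonic_le1 R l; have := harmonic_le1 R m.
  have := h0 (l + (l + m).+1).+1; lra.
have Z1fin : dzeta (2 * k).+2 1 \is a fin_num by exact: dzeta1_fin.
have Z2fin : dzeta 2 (2 * k).+1 \is a fin_num by exact: dzeta_fin.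
have Pfin : P \is a fin_num.
  have : P + 2%:E * dzeta (2 * k).+2 1 \is a fin_num.
    by rewrite E2 fin_numD Nfin.
  by rewrite fin_numD => /andP[].
have Sfin : S \is a fin_num.
  have : S + (4^-1 * zeta R (2 * k).+3)%:E \is a fin_num by rewrite E3.
  by rewrite fin_numD => /andP[].
have Ufin : U \is a fin_num.
  have : 2%:E * U + (2 * k + 1)%:R%:E * N \is a fin_num.
    by rewrite E1 fin_numD !fin_numM.
  rewrite fin_numD => /andP[+ _].
  rewrite -{2}(mul1e U) -{2}(mulVf (x := 2%R)) //.
  by rewrite EFinM -muleA => ?; rewrite fin_numM.
move: E1 E2 E3; rewrite -(fineK Ufin) -(fineK Nfin) -(fineK Pfin) -(fineK Sfin).
rewrite -{1}(fineK Z1fin) -{1}(fineK Z2fin) -!EFinM -!EFinD.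
move=> [E1] [E2] [E3]; congr _%:E; move: E1 E2 E3.
rewrite natrD natrM; move: (fine U) (fine N) (fine P) (fine S) => u n p s.
move: (fine _) (fine _) (zeta _ _) => z2 z1 z E1 E2 E3.
have {}E2 : p = (n + 2^-1 * z - 2 * z1)%R by rewrite -E2; ring.
have {}E3 : s = (z2 - 4^-1 * z)%R by rewrite -E3; ring.
apply: (@mulfI _ 2%R); first by [].
have -> : (2 * u = (2 * k%:R + 1) * p + 2 * s - (2 * k%:R + 1) * n)%R.
  by rewrite -E1; ring.
by rewrite E2 E3; field.
Qed.

End double_zeta_series.

Lemma dseries_parity_sum (R : realType) k :
  dseries (fun i j => parity_sum k (harmonic i : R) (harmonic j)) =
  (\sum_(1 <= n < k.+1) (2 * k%:R + 1 - 2 * n%:R)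
     * zeta R (2 * n + 1) * zeta R (2 * k + 2 - 2 * n))%:E.
Proof.
rewrite /parity_sum (dseries_sum k (F := fun n i j => (2 * (k - n) - 1)%:R
    * harmonic i ^+ (2 * n + 3) * harmonic j ^+ (2 * (k - n)))); last first.
  move=> n i j; apply: mulr_ge0; last exact: harmonic_pow_ge0.
  by rewrite mulr_ge0// harmonic_pow_ge0.
rewrite big_add1/= big_mkord -sumEFin; apply: eq_bigr => i _.
have ik := ltn_ord i.
rewrite (dseries_prod (s := (2 * (k - i) - 1)%:R * zeta R (2 * i + 3))
  (t := zeta R (2 * (k - i)))); last first.
- by rewrite zetaE//; lia.
- rewrite nneseriesZlR ?zetaE//; first by lia.
  by move=> n; exact: harmonic_pow_ge0.
- by move=> n; exact: harmonic_pow_ge0.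
- by move=> n; rewrite mulr_ge0// harmonic_pow_ge0.
congr (_ * _ * _)%:E.
- by rewrite natrB ?natrM ?natrB; [rewrite -natr1; ring|lia..].
- by congr zeta; lia.
- by congr zeta; lia.
Qed.

Theorem proposition11 (R : realType) (k : nat) (hk : (1 <= k)%N) :
  zeta_MT R (2 * k).+1 [tuple of 2%N :: nseq (2 * k) 1%N] 1 =
  ((2 * k)`!%:R *
     (zeta R 2 * zeta R (2 * k + 1)
      - 2^-1 * (2 * k%:R ^+ 2 + k%:R - 2) * zeta R (2 * k + 3)
      + \sum_(1 <= n < k)
          (2 * k%:R + 1 - 2 * n%:R)
          * zeta R (2 * n + 1) * zeta R (2 * k + 2 - 2 * n)))%:E.
Proof.
rewrite zeta_MT_double_sum EFinM; congr (_ * _)%E.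
rewrite [LHS](dseries_weighted_power_sum R (p := 2 * k)); last by lia.
have := dseries_parity_sum R k.
rewrite dseries_diagonal; last first.
  by move=> i j; rewrite parity_sum_ge0 ?harmonic_ge0.
rewrite -addeA -dseriesD; first last.
- by move=> i j; rewrite parity_sum_ge0 ?harmonic_ge0.
- by move=> i j; rewrite parity_sum_ge0 ?harmonic_ge0.
rewrite dseries_parity_sum_off_diagonal//.
under eq_nneseries do rewrite parity_sum_diag.
rewrite nneseriesZlR; last by move=> i; exact: harmonic_pow_ge0.
rewrite zetaE; last by lia.
rewrite big_nat_recr//= (_ : 2 * k + 2 - 2 * k = 2)%N; last by lia.
rewrite !addnS !addn0 -!EFinM -!EFinD => -[E]; congr _%:E.
move: E; move: (fine _) (fine _) (\sum_(1 <= i < k) _) => z2 z1 t E.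
have -> : t = k%:R ^+ 2 * zeta R (2 * k).+3 +
  (z1 - (2 * k).+1%:R * z2 + k%:R / 2 * zeta R (2 * k).+3) -
  (2 * k%:R + 1 - 2 * k%:R) * zeta R (2 * k).+1 * zeta R 2 by rewrite E; ring.
by field.
Qed.
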